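(* For $0\le u\le\pi/4$ and $L>0$ let $f_u(t)=F(t\cos u,t\sin u)$, $t\in[0,L]$, be the restriction of the Cilleruelo field $F$ to a segment of direction $u$ and length $L$, and let $\mathcal{Z}_f$ be the number of zeroes of $f_u$ in $[0,L]$. There exist positive constants $C_0,\dots,C_6$ (where $C_0$ may depend on $C_1$, and $C_5,C_6$ depend on $\epsilon>0$) such that: (i) $\mathbb{P}(\mathcal{Z}_f=0)=1-\frac{\sqrt2}{2}$ if $u=0$ and $L\ge2\pi$; (ii) $\mathbb{P}(\mathcal{Z}_f=0)\ge C_0>0$ in the regime $Lu\nearrow C_1<\pi/2$ (that is, $Lu$ tends to $C_1$ from below); (iii) $\mathbb{P}(\mathcal{Z}_f=0)\ge C_2\exp\!\big(-\frac{C_3}{(Lu-\pi/2)^2}\big)$ in the regime $Lu\nearrow\pi/2$ (that is, $Lu$ tends to $\pi/2$ from below); (iv) $\mathbb{P}(\mathcal{Z}_f=0)\le\exp(-C_4L^2\sin(u)^2)$ for $u$ fixed with $0<u<\pi/4$; (v) $\mathbb{P}(\mathcal{Z}_f=0)\ge C_5(\epsilon)>0$ if $L\sin(u)<\pi-\epsilon$; (vi) $\mathbb{P}(\mathcal{Z}_f=0)\le C_6(\epsilon)<1$ if $L\sin(u)>\pi/2+\epsilon$; (vii) $\mathbb{P}(\mathcal{Z}_f=0)=0$ if $u>0$ and $L\sin(u)\ge2\pi$.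
   Context: The Cilleruelo field is the Gaussian field on $\mathbb{R}^2$ given by $F(x)=\frac{\sqrt2}{2}[b_1\cos x_1+c_1\sin x_1+b_2\cos x_2+c_2\sin x_2]$, where $b_1,b_2,c_1,c_2$ are i.i.d. standard real Gaussians. *)

(* Defs.v *)
From HB Require Import structures.
From mathcomp Require Import all_boot all_order all_algebra.
From mathcomp Require Import all_classical all_reals all_analysis.
Import Order.TTheory GRing.Theory Num.Theory.
Import numFieldNormedType.Exports.

Set Implicit Arguments.
Unset Strict Implicit.
Unset Printing Implicit Defensive.

Local Open Scope classical_set_scope.
Local Open Scope ring_scope.

Definition mutually_independent (d : measure_display) (T : measurableType d)
    (R : realType) (P : probability T R) (I : finType)
    (X : I -> {RV P >-> R}) : Prop :=
  forall (J : {set I}) (B : I -> set R), (forall i, measurable (B i)) ->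
    P (\bigcap_(i in [set` J]) (X i @^-1` B i)) =
    (\prod_(i in J) P (X i @^-1` B i))%E.

(* normal_prob m s has mean m and standard deviation s. *)
Definition standard_normal (d : measure_display) (T : measurableType d)
    (R : realType) (P : probability T R) (X : {RV P >-> R}) : Prop :=
  forall B : set R, measurable B -> distribution P X B = normal_prob 0 1 B.

Definition iid_standard_normal (d : measure_display) (T : measurableType d)
    (R : realType) (P : probability T R) (n : nat)
    (X : n.-tuple {RV P >-> R}) : Prop :=
  mutually_independent (tnth X) /\ forall i, standard_normal (tnth X i).

Definition cilleruelo_field (R : realType) (T : Type) (b1 b2 c1 c2 : T -> R)
    (x : R * R) (w : T) : R :=
  Num.sqrt 2 / 2 * (b1 w * cos x.1 + c1 w * sin x.1 +
                    b2 w * cos x.2 + c2 w * sin x.2).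

Definition restriction_to_segment (R : realType) (T : Type)
    (F : R * R -> T -> R) (u : R) (t : R) (w : T) : R :=
  F (t * cos u, t * sin u) w.

(* The number of zeroes lives in \bar R: it is +oo when there are infinitely
   many of them (e.g. when all the coefficients vanish). *)
Definition number_of_zeroes (R : realType) (T : Type) (f : R -> T -> R)
    (L : R) (w : T) : \bar R :=
  counting [set t | t \in `[0, L] /\ f t w = 0].

Definition persistence_probability (d : measure_display) (T : measurableType d)
    (R : realType) (P : probability T R) (F : R * R -> T -> R)
    (u L : R) : \bar R :=
  P [set w | number_of_zeroes (restriction_to_segment F u) L w = 0%E].

(* Main.v *)
Require Import Defs.
From HB Require Import structures.
From mathcomp Require Import all_boot all_order all_algebra.
From mathcomp Require Import all_classical all_reals all_analysis.
From mathcomp Require Import measurable_realfun ring lra.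
Import Order.TTheory GRing.Theory Num.Theory.
Import numFieldNormedType.Exports.
Set Implicit Arguments.
Unset Strict Implicit.
Unset Printing Implicit Defensive.
Local Open Scope classical_set_scope.
Local Open Scope ring_scope.

(** Up to the factor sqrt 2 / 2, the field along direction u is the sum of a
    fast wave b1 cos (t cos u) + c1 sin (t cos u) and of a slow wave
    b2 cos (t sin u) + c2 sin (t sin u). Everything follows from comparing
    the two.

    A wave that completes a period on [0, L] reaches both its amplitude and the
    opposite of it, so that it forces a zero as soon as its amplitude dominates
    the other one ([wave_has_zero]). When L sin u >= 2 pi both waves complete a
    period and there is always a zero. When u = 0 and L >= 2 pi the slow wave is
    the constant b2, and there is no zero exactly when b2 lies outside the
    range of the fast wave, that is when (b2, b1, c1) is in the cone
    b2 ^ 2 > b1 ^ 2 + c1 ^ 2. Since b1 ^ 2 + c1 ^ 2 exceeds s with probability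
    exp (- s / 2) ([normal_prob2_radius]), the complement of the cone has
    probability E [exp (- b2 ^ 2 / 2)] = sqrt 2 / 2.

    The other bounds come from boxes: the coefficients lie in a product of four
    segments with a probability that factors, so each bound only needs a box on
    which a zero is excluded or forced.
    - If the slow wave covers less than half a turn, it has a box where it is
      everywhere larger than the amplitude of the fast wave
      ([slow_box_no_zero]). The two regimes where L u stays below pi / 2 are
      instances of it, because L sin u <= L u.
    - If the slow wave covers more than a quarter turn, it has a box where its
      change of sign imposes a zero ([quarter_turn_box_zero]).
    - For every small x <= L sin u, a positive initial value of order x
      with a steep negative slope gives a zero; this box has probability of
      order x ^ 2 ([short_box_zero]). Taking x proportional to L sin u bounds
      the persistence probability by 1 - c (L sin u) ^ 2, hence by
      exp (- c (L sin u) ^ 2). This suffices because the probability vanishes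
      once L sin u >= 2 pi.

    As a measure is only monotone on measurable sets, all this needs the
    zero-free event to be measurable: by compactness, a continuous function has
    no zero on a segment exactly when its absolute value is bounded below by
    some 1 / n on the rational points of the segment
    ([measurable_zero_free]). *)

(** * Waves and their zeros *)

Section waves.
Context {R : realType}.
Implicit Types (b c r s t x y L u eps : R).

(** The frequencies are left free so that the roles of the two waves can be
    exchanged; direction u is the case p = cos u and q = sin u. *)
Definition wave b1 c1 b2 c2 p q t :=
  b1 * cos (t * p) + c1 * sin (t * p) + b2 * cos (t * q) + c2 * sin (t * q).

Lemma continuous_wave b1 c1 b2 c2 p q : continuous (wave b1 c1 b2 c2 p q).
Proof.
have cscale p0 : continuous (fun t : R => t * p0).
  by move=> x; apply: cvgM; [exact: cvg_id|exact: cvg_cst].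
have ccos b p0 : continuous (fun t => b * cos (t * p0)).
  move=> x; apply: cvgM; first exact: cvg_cst.
  by apply: (continuous_comp (cscale p0 x)); exact: continuous_cos.
have csin b p0 : continuous (fun t => b * sin (t * p0)).
  move=> x; apply: cvgM; first exact: cvg_cst.
  by apply: (continuous_comp (cscale p0 x)); exact: continuous_sin.
move=> x; apply: cvgD; [apply: cvgD; [apply: cvgD|]|].
all: by [exact: ccos|exact: csin].
Qed.

Lemma zero_of_opposite_signs (f : R -> R) L s t : continuous f ->
  s \in `[0, L] -> t \in `[0, L] -> 0 <= f s -> f t <= 0 ->
  exists2 r, r \in `[0, L] & f r = 0.
Proof.
rewrite !in_itv/= => cf /andP[s0 sL] /andP[t0 tL] fs ft.
have [st|/ltW ts] := leP s t.
- have [||r] := @IVT R f s t 0 st; first exact: continuous_subspaceT.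
    by rewrite ge_min le_max fs ft orbT.
  rewrite in_itv/= => /andP[sr rt] fr; exists r => //.
  by rewrite in_itv/= (le_trans s0 sr) (le_trans rt tL).
- have [||r] := @IVT R f t s 0 ts; first exact: continuous_subspaceT.
    by rewrite ge_min le_max fs ft orbT.
  rewrite in_itv/= => /andP[sr rt] fr; exists r => //.
  by rewrite in_itv/= (le_trans t0 sr) (le_trans rt sL).
Qed.

Lemma sinusoid_le b c x : b * cos x + c * sin x <= Num.sqrt (b ^+ 2 + c ^+ 2).
Proof.
rewrite (le_trans (ler_norm _))// -sqrtr_sqr ler_wsqrtr//.
have := cos2Dsin2 x; have := sqr_ge0 (b * sin x - c * cos x); nra.
Qed.

Lemma sinusoid_ge b c x :
  - Num.sqrt (b ^+ 2 + c ^+ 2) <= b * cos x + c * sin x.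
Proof. by have := sinusoid_le (- b) (- c) x; rewrite !sqrrN; lra. Qed.

(** The maximum is reached at the polar angle of (b, c). *)
Lemma sinusoid_max b c : exists2 x, 0 <= x <= 2 * pi &
  b * cos x + c * sin x = Num.sqrt (b ^+ 2 + c ^+ 2).
Proof.
set r := Num.sqrt _.
have r0 : 0 <= r := sqrtr_ge0 _.
have r2 : r ^+ 2 = b ^+ 2 + c ^+ 2 by rewrite sqr_sqrtr// addr_ge0// sqr_ge0.
have pi0 := @pi_ge0 R.
have [/eqP r_eq0|r_neq0] := boolP (r == 0).
  exists 0; first by rewrite lexx/=; lra.
  rewrite r_eq0 expr0n/= in r2.
  have -> : b = 0 by have := sqr_ge0 b; have := sqr_ge0 c => *; nra.
  have -> : c = 0 by have := sqr_ge0 b; have := sqr_ge0 c => *; nra.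
  by rewrite !mul0r addr0 r_eq0.
have rgt0 : 0 < r by rewrite lt_neqAle eq_sym r_neq0.
have cr : -1 <= b / r <= 1.
  by rewrite ler_pdivlMr// ler_pdivrMr//; have := sqr_ge0 c; nra.
have cosE : cos (acos (b / r)) = b / r by rewrite acosK.
have sinE : sin (acos (b / r)) = `|c| / r.
  rewrite sin_acos// (_ : 1 - _ = (c / r) ^+ 2).
    by rewrite sqrtr_sqr normrM normfV (ger0_norm r0).
  rewrite !expr_div_n r2; field.
  by rewrite -r2 expf_neq0.
have target : r = (b ^+ 2 + c ^+ 2) / r by rewrite -r2 expr2 mulfK.
have a0 := acos_ge0 cr; have api := acos_lepi cr.
have [c0|c0] := leP 0 c.
  exists (acos (b / r)); first by rewrite a0/=; lra.
  by rewrite cosE sinE ger0_norm// {3}target; ring.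
(* a negative c puts the phase of (b, c) in the lower half plane *)
exists (2 * pi - acos (b / r)); first by apply/andP; split; lra.
have -> : 2 * pi - acos (b / r) = - acos (b / r) + pi *+ 2 by ring.
rewrite cosD2pi sinD2pi cosN sinN cosE sinE ltr0_norm// {3}target; ring.
Qed.

Lemma sinusoid_min b c : exists2 x, 0 <= x <= 2 * pi &
  b * cos x + c * sin x = - Num.sqrt (b ^+ 2 + c ^+ 2).
Proof.
have [x x02pi xE] := sinusoid_max (- b) (- c); exists x => //.
by move: xE; rewrite !sqrrN => <-; ring.
Qed.

(** Over a full period the first wave reaches its amplitude and the opposite
    value, and the second wave is too small to change either sign. *)
Lemma wave_has_zero b1 c1 b2 c2 p q L : 0 < p -> 2 * pi <= L * p ->
  b2 ^+ 2 + c2 ^+ 2 <= b1 ^+ 2 + c1 ^+ 2 ->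
  exists2 t, t \in `[0, L] & wave b1 c1 b2 c2 p q t = 0.
Proof.
move=> p0 Lp; rewrite -ler_sqrt ?addr_ge0 ?sqr_ge0// => r21.
have scale x : 0 <= x <= 2 * pi -> x / p \in `[0, L].
  move=> /andP[x0 x2pi]; rewrite in_itv/= divr_ge0 ?(ltW p0)//=.
  by rewrite ler_pdivrMr// (le_trans x2pi).
have [x /scale xL xE] := sinusoid_max b1 c1.
have [y /scale yL yE] := sinusoid_min b1 c1.
apply: (zero_of_opposite_signs (@continuous_wave b1 c1 b2 c2 p q) xL yL).
  rewrite /wave divfK ?gt_eqF// xE.
  by have := sinusoid_ge b2 c2 (x / p * q); lra.
rewrite /wave divfK ?gt_eqF// yE.
by have := sinusoid_le b2 c2 (y / p * q); lra.
Qed.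

Lemma wave_swap b1 c1 b2 c2 p q t :
  wave b1 c1 b2 c2 p q t = wave b2 c2 b1 c1 q p t.
Proof. by rewrite /wave; ring. Qed.

(** Both waves complete a period, so that [wave_has_zero] applies to the
    one with the larger amplitude. *)
Lemma wave_has_zero_slow b1 c1 b2 c2 p q L : 0 < q -> q <= p ->
  2 * pi <= L * q -> exists2 t, t \in `[0, L] & wave b1 c1 b2 c2 p q t = 0.
Proof.
move=> q0 qp Lq.
have [r21|/ltW r12] := leP (b2 ^+ 2 + c2 ^+ 2) (b1 ^+ 2 + c1 ^+ 2).
  apply: wave_has_zero => //; first exact: lt_le_trans qp.
  have := @pi_gt0 R; nra.
have [t tL t0] := @wave_has_zero b2 c2 b1 c1 q p L q0 Lq r12.
by exists t => //; rewrite wave_swap.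
Qed.

Lemma sin_le_cos u : 0 <= u <= pi / 4 -> 0 <= sin u <= cos u.
Proof.
have pi0 := @pi_gt0 R.
move=> /andP[u0 u4]; rewrite sin_ge0_pi/=; last by apply/andP; split; lra.
rewrite -[cos u]cosN -[leRHS]sinDpihalf.
rewrite leNgt ltr_sin ?in_itv/= -?leNgt; first by lra.
  by apply/andP; split; lra.
by apply/andP; split; lra.
Qed.

(** The fast wave is at least - 2. The slow wave, at phase s < pi - eps, is at
    least 3: as long as cos s >= 0 both of its terms help, and afterwards
    sin s >= sin eps, so that c2 sin s >= 7 absorbs b2 cos s >= - 4. *)
Lemma slow_box_no_zero eps u L b1 c1 b2 c2 t :
  0 < eps <= 1 -> 0 <= u <= pi / 4 -> L * sin u < pi - eps ->
  b1 \in `[-1, 1] -> c1 \in `[-1, 1] -> b2 \in `[3, 4] -> 7 / sin eps <= c2 ->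
  t \in `[0, L] -> wave b1 c1 b2 c2 (cos u) (sin u) t != 0.
Proof.
rewrite !in_itv/= => /andP[e0 e1] /sin_le_cos/andP[su _] Lu.
move=> /andP[b1l b1u] /andP[c1l c1u] /andP[b2l b2u] c2l /andP[t0 tL].
have pi2 := @pi_ge2 R.
have se : 0 < sin eps by rewrite sin_gt0_pi// e0/=; lra.
have c27 : 7 <= c2 * sin eps by rewrite -ler_pdivrMr.
have c20 : 7 <= c2 by have := sin_le1 eps; nra.
set s := t * sin u.
have s0 : 0 <= s by rewrite mulr_ge0.
have sl : s <= pi - eps by rewrite (le_trans _ (ltW Lu))// ler_wpM2r.
have ss : 0 <= sin s by rewrite sin_ge0_pi// s0/=; lra.
have fast : -2 <= b1 * cos (t * cos u) + c1 * sin (t * cos u).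
  have := cos_le1 (t * cos u); have := cos_geN1 (t * cos u).
  have := sin_le1 (t * cos u); have := sin_geN1 (t * cos u) => *.
  have : -1 <= b1 * cos (t * cos u) by nra.
  have : -1 <= c1 * sin (t * cos u) by nra.
  lra.
have slow : 3 <= b2 * cos s + c2 * sin s.
  have cs1 := cos2Dsin2 s; have cl := cos_le1 s; have sl1 := sin_le1 s.
  have cg := cos_geN1 s.
  have [c0|c0] := leP 0 (cos s).
    have : 1 <= cos s + sin s by nra.
    have : 0 <= (b2 - 3) * cos s by rewrite mulr_ge0// subr_ge0.
    have : 0 <= (c2 - 3) * sin s by rewrite mulr_ge0//; lra.
    lra.
  have ces : - cos eps <= cos s.
    have -> : - cos eps = cos (pi - eps).
      by rewrite cosB cospi sinpi; ring.
    by rewrite leNgt ltr_cos ?in_itv/= -?leNgt//; apply/andP; split; lra.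
  have e1' := cos2Dsin2 eps.
  have ses : sin eps <= sin s.
    have : sin eps ^+ 2 <= sin s ^+ 2 by nra.
    by rewrite ler_sqr// nnegrE ltW.
  have : 7 <= c2 * sin s by nra.
  have : -4 <= b2 * cos s by nra.
  lra.
by rewrite /wave gt_eqF// -/s; lra.
Qed.

(** At phase pi / 2 + eps the term in b2 has become - b2 sin eps <= - 3, while
    the other three terms are at most 1 each. *)
Lemma quarter_turn_box_zero eps u L b1 c1 b2 c2 :
  0 < eps <= 1 -> 0 <= u <= pi / 4 -> pi / 2 + eps < L * sin u ->
  b1 \in `[-1, 1] -> c1 \in `[-1, 1] -> 3 / sin eps <= b2 ->
  c2 \in `[-1, 1] ->
  exists2 t, t \in `[0, L] & wave b1 c1 b2 c2 (cos u) (sin u) t = 0.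
Proof.
rewrite !in_itv/= => /andP[e0 e1] /sin_le_cos/andP[su _] Lu.
move=> /andP[b1l b1u] /andP[c1l c1u] b2l /andP[c2l c2u].
have pi2 := @pi_ge2 R.
have se : 0 < sin eps by rewrite sin_gt0_pi// e0/=; lra.
have b23 : 3 <= b2 * sin eps by rewrite -ler_pdivrMr.
have b20 : 3 <= b2 by have := sin_le1 eps; nra.
have su0 : 0 < sin u.
  by rewrite lt_neqAle su eq_sym andbT; apply/eqP => u0; rewrite u0 in Lu; lra.
have L0 : 0 <= L by nra.
pose t := (pi / 2 + eps) / sin u.
have tu : t * sin u = eps + pi / 2 by rewrite divfK ?gt_eqF// addrC.
apply: (@zero_of_opposite_signs _ L 0 t).
- exact: continuous_wave.
- by rewrite in_itv/= lexx.
- rewrite in_itv/= divr_ge0 ?ler_pdivrMr//; [exact: ltW|lra].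
- by rewrite /wave !mul0r cos0 sin0; lra.
rewrite /wave tu cosDpihalf sinDpihalf.
have := cos_le1 (t * cos u); have := cos_geN1 (t * cos u).
have := sin_le1 (t * cos u); have := sin_geN1 (t * cos u).
have := cos_le1 eps; have := cos_geN1 eps => *.
have : b1 * cos (t * cos u) <= 1 by nra.
have : c1 * sin (t * cos u) <= 1 by nra.
have : c2 * cos eps <= 1 by nra.
lra.
Qed.

(** The initial value b1 + b2 is at most 2 sin x, and when the phase of the fast
    wave reaches x the term in c1 has removed 3 sin x. Only b1 and b2 are
    confined to a short segment, hence a probability of order x ^ 2. *)
Lemma short_box_zero x u L b1 c1 b2 c2 :
  0 <= x <= 2^-1 -> 0 <= u <= pi / 4 -> x <= L * sin u -> 0 < L ->
  b1 \in `[0, sin x] -> c1 \in `[-4, -3] -> b2 \in `[0, sin x] ->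
  c2 \in `[-1, 0] ->
  exists2 t, t \in `[0, L] & wave b1 c1 b2 c2 (cos u) (sin u) t = 0.
Proof.
rewrite !in_itv/= => /andP[x0 x1] /sin_le_cos/andP[su suc] Lu L0.
move=> /andP[b1l b1u] /andP[c1l c1u] /andP[b2l b2u] /andP[c2l c2u].
have pi2 := @pi_ge2 R.
have cu0 : 0 < cos u.
  by have := cos2Dsin2 u; rewrite lt_neqAle (le_trans su)// andbT => ?;
     apply/eqP => cu; move: suc; rewrite -cu => ?; nra.
pose t := x / cos u.
have tu : t * cos u = x by rewrite divfK ?gt_eqF.
have t0 : 0 <= t by rewrite divr_ge0// ltW.
have xs : 0 <= sin x by rewrite sin_ge0_pi// x0/=; lra.
apply: (@zero_of_opposite_signs _ L 0 t).
- exact: continuous_wave.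
- by rewrite in_itv/= lexx ltW.
- by rewrite in_itv/= t0 ler_pdivrMr//; nra.
- by rewrite /wave !mul0r cos0 sin0; lra.
have ts0 : 0 <= t * sin u by rewrite mulr_ge0.
have ts1 : t * sin u <= x by rewrite -tu ler_wpM2l.
have : 0 <= sin (t * sin u) by rewrite sin_ge0_pi// ts0/=; lra.
rewrite /wave tu.
have := cos_le1 (t * sin u); have := cos_le1 x => *.
have : b1 * cos x <= sin x by nra.
have : b2 * cos (t * sin u) <= sin x by nra.
have : c1 * sin x <= - 3 * sin x by nra.
have : c2 * sin (t * sin u) <= 0 by nra.
lra.
Qed.

(** By the mean value theorem, the slope of sin being at least cos 1 there. *)
Lemma sin_ge_linear x : 0 <= x <= 2^-1 -> cos 1 * x <= sin x.
Proof.
move=> /andP[x0 x1].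
have [|c] := @MVT_segment R sin cos 0 x x0 (fun y _ => is_derive_sin y).
  by apply: continuous_subspaceT; exact: continuous_sin.
rewrite sin0 !subr0 in_itv/= => /andP[c0 cx] ->.
have pi2 := @pi_ge2 R.
have c1 : c <= 1 by lra.
have cI : c \in `[0, pi] by rewrite in_itv/= c0/=; lra.
have oneI : 1 \in `[0 : R, pi] by rewrite in_itv/= ler01/=; lra.
by rewrite ler_wpM2r// leNgt ltr_cos// -leNgt.
Qed.

End waves.

(** * The zero-free event and boxes of coefficients *)

Section zero_free_event.
Context d (T : measurableType d) (R : realType).

Lemma counting_eq0 (S : choiceType) (A : set S) :
  counting A = 0%E :> \bar R -> A = set0.
Proof.
rewrite /counting; case: asboolP => // finA [] /eqP.
by rewrite pnatr_eq0 => /eqP/finmap.cardfs0_eq; exact: fset_set_set0.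
Qed.

Lemma number_of_zeroes_eq0 (f : R -> T -> R) L w :
  number_of_zeroes f L w = 0%E <-> forall t, t \in `[0, L] -> f t w != 0.
Proof.
split=> [/counting_eq0 noz t tL|noz].
  by apply/eqP => ft; have : set0 t by rewrite -noz.
rewrite /number_of_zeroes (_ : [set _ | _] = set0).
  by rewrite /counting asboolT// fset_set0.
by rewrite -subset0 => t [/noz/eqP].
Qed.

(** The minimum of |f| on the segment is positive when f has no zero, hence
    larger than some 1 / n; conversely such a bound on the rational points
    extends to the segment by continuity. *)
Lemma measurable_zero_free (f : R -> T -> R) L : 0 < L ->
  (forall t, measurable_fun setT (f t)) -> (forall w, continuous (f ^~ w)) ->
  measurable [set w | forall t, t \in `[0, L] -> f t w != 0].
Proof.
move=> L0 mf cf; pose q k : R := ratr (odflt (0 : rat) (unpickle k)).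
pose D := [set k | 0 < q k < L].
rewrite (_ : [set w | _] = \bigcup_n \bigcap_(k in D)
    [set w | n.+1%:R^-1 <= `|f (q k) w|]).
  apply: bigcup_measurable => n _; apply: bigcap_measurableType => k _.
  rewrite -[X in measurable X]setTI; apply: measurable_fun_le => //.
  exact: measurableT_comp.
apply/seteqP; split=> [w fw|w [n _ fw] t].
  have [|c cL cmin] := @EVT_min R (fun t => `|f t w|) 0 L (ltW L0).
    apply: continuous_subspaceT => x.
    by apply: (continuous_comp (cf w x)); exact: norm_continuous.
  have : 0 < `|f c w| by rewrite normr_gt0 fw.
  move=> /ltr_add_invr[n]; rewrite add0r => nc.
  exists n => // k /= /andP[qk0 qkL].
  by rewrite (le_trans (ltW nc))// cmin// in_itv/= !ltW.
rewrite in_itv/= => /andP[t0 tL]; apply/eqP => ft0.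
have n0 : (0 : R) < n.+1%:R^-1 by rewrite invr_gt0.
have /cvgrPdist_lt/(_ _ n0)[e /= e0 he] := cf w t.
(* intersecting with the open segment also handles the case where t is an
   endpoint *)
have [r] : exists r : rat, ratr r \in `]Num.max 0 (t - e), Num.min L (t + e)[.
  by apply: rat_in_itvoo; rewrite lt_min !gt_max; lra.
rewrite in_itv/= gt_max lt_min => /andP[/andP[r0 rte] /andP[rL ret]].
have qr : q (pickle r) = ratr r by rewrite /q pickleK.
have := fw (pickle r); rewrite /D/= qr r0 rL => /(_ isT).
rewrite leNgt => /negP; apply.
have := he (ratr r); rewrite ft0 sub0r normrN; apply.
by rewrite /ball/= ltr_norml; lra.
Qed.

End zero_free_event.

Section gaussian_interval.
Context {R : realType}.
Implicit Types a b M : R.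

Definition normal_segment a b : R := fine (@normal_prob R 0 1 `[a, b]).

Lemma normal_segmentE a b :
  @normal_prob R 0 1 `[a, b] = (normal_segment a b)%:E.
Proof. by rewrite fineK// fin_num_measure. Qed.

(** The density decreases with |x|, so it is at least its value at M on the
    whole segment. *)
Lemma normal_segment_ge a b M : a <= b -> `|a| <= M -> `|b| <= M ->
  (b - a) * normal_pdf 0 1 M <= normal_segment a b.
Proof.
move=> ab aM bM; rewrite -lee_fin -normal_segmentE /normal_prob.
apply: (@le_trans _ _
  (\int[lebesgue_measure]_(x in `[a, b]) (normal_pdf 0 1 M)%:E)%E).
  rewrite integral_cst//= lebesgue_measure_itv/= lte_fin.
  have [ab'|ba] := ltP a b; first by rewrite -EFinD -EFinM mulrC.
  rewrite mule0 lee_fin (_ : b - a = 0) ?mul0r//; lra.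
apply: ge0_le_integral => //=.
- by move=> x _; rewrite lee_fin normal_pdf_ge0.
- apply/measurable_EFinP; apply: measurable_funTS.
  exact: measurable_normal_pdf.
move=> x; rewrite in_itv/= lee_fin => /andP[ax xb].
rewrite !normal_pdfE ?oner_neq0// ler_wpM2l ?normal_peak_ge0//.
rewrite /normal_fun ler_expR !subr0 !mulNr lerN2 ler_pM2r ?invr_gt0//.
have : `|x| <= M.
  by move: aM bM; rewrite !ler_norml => /andP[? ?] /andP[? ?]; lra.
move=> xM; rewrite -(real_normK (num_real x)) ler_sqr ?nnegrE//.
by rewrite (le_trans _ xM).
Qed.

Lemma normal_pdf_gt0 M : 0 < normal_pdf 0 1 M :> R.
Proof.
by rewrite normal_pdfE ?oner_neq0// mulr_gt0 ?expR_gt0 ?normal_peak_gt0 ?oner_neq0.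
Qed.

Lemma normal_segment_gt0 a b : a < b -> 0 < normal_segment a b.
Proof.
move=> ab; apply: (lt_le_trans _ (@normal_segment_ge _ _ (`|a| + `|b|) _ _ _)).
- by rewrite mulr_gt0 ?normal_pdf_gt0// subr_gt0.
- exact: ltW.
- by rewrite lerDl.
- by rewrite lerDr.
Qed.

Lemma normal_segment_ge0 a b : 0 <= normal_segment a b.
Proof. by rewrite fine_ge0// measure_ge0. Qed.

Lemma normal_segment_le1 a b : normal_segment a b <= 1.
Proof. by rewrite -lee_fin -normal_segmentE probability_le1. Qed.

End gaussian_interval.

Section boxes.
Context d (T : measurableType d) (R : realType) (P : probability T R).
Context (b1 b2 c1 c2 : {RV P >-> R}).
Hypothesis iid : iid_standard_normal [tuple b1; b2; c1; c2].

(** Events that involve only some of the coefficients are recovered by taking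
    the full line for the others. *)
Lemma iid_box (A B C D : set R) :
  measurable A -> measurable B -> measurable C -> measurable D ->
  P [set w | [/\ A (b1 w), C (c1 w), B (b2 w) & D (c2 w)]] =
  (normal_prob 0 1 A * normal_prob 0 1 C *
   normal_prob 0 1 B * normal_prob 0 1 D)%E.
Proof.
move=> mA mB mC mD; have [indep norm] := iid.
pose X := [tuple b1; b2; c1; c2]; pose S := [tuple A; B; C; D].
have mS i : measurable (tnth S i).
  by case: i => -[|[|[|[|//]]]] ?.
have := indep [set: 'I_4]%SET (tnth S) mS.
rewrite [X in P X](_ : _ =
    [set w | [/\ A (b1 w), C (c1 w), B (b2 w) & D (c2 w)]]); last first.
  apply/seteqP; split=> [w Xw|w [Aw Cw Bw Dw] i _] /=.
    have XS i : tnth S i (tnth X i w) by apply: (Xw i); rewrite /= inE.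
    split.
    - exact: (XS (@Ordinal 4 0 isT)).
    - exact: (XS (@Ordinal 4 2 isT)).
    - exact: (XS (@Ordinal 4 1 isT)).
    - exact: (XS (@Ordinal 4 3 isT)).
  rewrite (tnth_nth setT) (tnth_nth b1).
  by case: i => -[|[|[|[|//]]]].
move=> ->.
rewrite big_mkcond/= !big_ord_recl big_ord0 !inE mule1.
have E i B0 : measurable B0 -> P (tnth X i @^-1` B0) = normal_prob 0 1 B0.
  by move=> mB0; rewrite -(norm i B0 mB0).
rewrite !E// !(tnth_nth setT)/=.
rewrite !muleA; congr (_ * _)%E.
by rewrite -!muleA; congr (_ * _)%E; rewrite muleC.
Qed.

(** A counting measure vanishes only on the empty set, and the factor
    sqrt 2 / 2 of the field does not affect its zeros. *)
Lemma persistenceE u L : persistence_probability P (cilleruelo_field b1 b2 c1 c2) u L =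
  P [set w | forall t, t \in `[0, L] ->
     wave (b1 w) (c1 w) (b2 w) (c2 w) (cos u) (sin u) t != 0].
Proof.
rewrite /persistence_probability; congr (P _); apply/seteqP.
have s2 : Num.sqrt 2 / 2 != 0 :> R by rewrite mulf_neq0// gt_eqF// sqrtr_gt0.
split=> w /=.
  move=> /number_of_zeroes_eq0 noz t /noz.
  by rewrite mulf_eq0 (negPf s2).
move=> noz; apply/number_of_zeroes_eq0 => t /noz.
by rewrite /restriction_to_segment /cilleruelo_field mulf_eq0 (negPf s2).
Qed.

Lemma measurable_zero_free_wave p q L : 0 < L ->
  measurable [set w | forall t, t \in `[0, L] ->
     wave (b1 w) (c1 w) (b2 w) (c2 w) p q t != 0].
Proof.
move=> L0; apply: (@measurable_zero_free _ _ _
  (fun t w => wave (b1 w) (c1 w) (b2 w) (c2 w) p q t)) => //.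
- by move=> t; rewrite /wave; do !apply: measurable_funD; exact: measurable_funM.
- by move=> w; exact: continuous_wave.
Qed.

Variables (u L : R).
Hypothesis L0 : 0 < L.
Local Notation p := (persistence_probability P (cilleruelo_field b1 b2 c1 c2) u L).

Section segments.
Variables (a1 a2 a3 a4 e1 e2 e3 e4 : R).
Let E := [set w | [/\ b1 w \in `[a1, e1], c1 w \in `[a2, e2],
  b2 w \in `[a3, e3] & c2 w \in `[a4, e4]]].
Let q := normal_segment a1 e1 * normal_segment a2 e2 *
  normal_segment a3 e3 * normal_segment a4 e4.

Let PE : P E = q%:E.
Proof.
rewrite [LHS](@iid_box `[a1, e1] `[a3, e3] `[a2, e2] `[a4, e4])//.
by rewrite !normal_segmentE.
Qed.

Let mE : measurable E.
Proof.
have mX (X : {RV P >-> R}) a e : measurable [set w | X w \in `[a, e]].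
  rewrite -[X in measurable X]setTI.
  exact: (measurable_funP X measurableT _ (measurable_itv `[a, e])).
rewrite (_ : E = [set w | b1 w \in `[a1, e1]] `&` [set w | c1 w \in `[a2, e2]]
  `&` [set w | b2 w \in `[a3, e3]] `&` [set w | c2 w \in `[a4, e4]]).
  by do !apply: measurableI; exact: mX.
by apply/seteqP; split=> w /=; [move=> []|move=> [[[]]]].
Qed.

Lemma persistence_ge_box :
  (forall w, E w -> forall t, t \in `[0, L] ->
    wave (b1 w) (c1 w) (b2 w) (c2 w) (cos u) (sin u) t != 0) ->
  (q%:E <= p)%E.
Proof.
move=> Enoz; rewrite -PE persistenceE le_measure ?inE//.
exact: measurable_zero_free_wave.
Qed.

Lemma persistence_le_box :
  (forall w, E w -> exists2 t, t \in `[0, L] &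
    wave (b1 w) (c1 w) (b2 w) (c2 w) (cos u) (sin u) t = 0) ->
  (p <= (1 - q)%:E)%E.
Proof.
move=> Ez; rewrite EFinB -PE -probability_setC// persistenceE le_measure ?inE//.
- exact: measurable_zero_free_wave.
- exact: measurableC.
- by move=> w /= noz /Ez[t /noz/eqP].
Qed.

End segments.

End boxes.

(** * The radius of a Gaussian vector of the plane *)

Section normal_integrals.
Context {R : realType}.
Implicit Types (a c k s t v x y : R).
Local Notation mu := (@lebesgue_measure R).
Local Notation phi := (@normal_pdf R 0 1).
Local Notation N := (@normal_prob R 0 1).

Lemma integral_indicM d (T : measurableType d) (m : {measure set T -> \bar R})
    (D : set T) (f : T -> R) :
  (\int[m]_(x in D) (f x)%:E = \int[m]_x (f x * \1_D x)%:E)%E.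
Proof.
rewrite integral_mkcond; apply: eq_integral => x _.
by rewrite patchE indicE; case: (x \in D); rewrite ?mulr1 ?mulr0.
Qed.

(** The density of a normal law is its Radon-Nikodym derivative, up to a
    negligible set. *)
Lemma integral_normal_prob (f : R -> R) : measurable_fun setT f ->
  (forall x, 0 <= f x <= 1) ->
  (\int[N]_x (f x)%:E = \int[mu]_x (f x * phi x)%:E)%E.
Proof.
move=> mf f01.
have fint : (N : {measure set _ -> \bar R}).-integrable setT (EFin \o f).
  apply: (@le_integrable _ _ _ _ setT measurableT _ (cst 1%E)) => //.
  - exact/measurable_EFinP.
  - move=> x _ /=; rewrite lee_fin normr1; have /andP[f0 f1] := f01 x.
    by rewrite ger0_norm.
  - exact: finite_measure_integrable_cst.
rewrite -(Radon_Nikodym_change_of_variables (normal_prob_dominates 0 1) _ fint)//.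
apply: ae_eq_integral => //.
- apply: emeasurable_funM; first exact/measurable_EFinP.
  apply: (measurable_int mu); apply: Radon_Nikodym_integrable.
  exact: normal_prob_dominates.
- apply/measurable_EFinP; apply: measurable_funM => //.
  exact: measurable_normal_pdf.
- under [X in ae_eq _ _ _ X]eq_fun do rewrite EFinM.
  apply: ae_eqe_mul2l => /=.
  rewrite Radon_NikodymE//=; first exact: normal_prob_dominates.
  move=> dom; case: cid => /= h [h1 h2 h3].
  apply: integral_ae_eq => //=.
  + by apply/measurable_EFinP; exact: measurable_normal_pdf.
  + by move=> E _ mE; rewrite -h3.
Qed.

Lemma ge0_integral_even (f : R -> R) : measurable_fun setT f ->
  (forall x, 0 <= f x) -> (forall x, f (- x) = f x) ->
  (\int[mu]_x (f x)%:E = 2%:E * \int[mu]_(x in `[0%R, +oo[) (f x)%:E)%E.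
Proof.
move=> mf f0 fN; have mfE : measurable_fun setT (EFin \o f).
  exact/measurable_EFinP.
have := @ge0_integration_by_substitution0 R (EFin \o f) mfE.
have -> : (fun r => (EFin \o f) (- r)%R) = EFin \o f by apply/funext => r /=; rewrite fN.
move=> /(_ (fun x => f0 x)) half.
rewrite -[in LHS](setUv `[0, +oo[%classic) ge0_integral_setU//=; last 4 first.
- exact: measurableC.
- by rewrite setUv.
- by move=> x _; rewrite lee_fin.
- exact/disj_setPCl.
rewrite mule_natl mule2n; congr +%E.
by rewrite setCitvr integral_itv_bndo_bndc//; exact: measurable_funTS.
Qed.

Lemma normal_pdf01E x : phi x = normal_peak 1 * expR (- (x ^+ 2 / 2)).
Proof.
rewrite normal_pdfE ?oner_neq0// /normal_fun subr0 expr1n.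
by rewrite mulNr.
Qed.

Lemma normal_peak1_sqr : normal_peak (1 : R) ^+ 2 * pi *+ 2 = 1.
Proof.
have pi0 := @pi_gt0 R.
rewrite /normal_peak exprVn expr1n mul1r sqr_sqrtr; last first.
  by rewrite mulrn_wge0// ltW.
by rewrite -mulrnAr mulVf// mulrn_eq0/= gt_eqF.
Qed.

Lemma sqrt_le y t : 0 <= y -> (Num.sqrt t <= y) = (t <= y ^+ 2).
Proof.
by move=> y0; rewrite -[X in _ <= X](ger0_norm y0) -sqrtr_sqr ler_sqrt ?sqr_ge0.
Qed.

Lemma normal_prob_sqr_ge t : (N [set y : R | (t <= y ^+ 2)%R] =
  2%:E * \int[mu]_(y in `[Num.sqrt t, +oo[) (phi y)%:E)%E.
Proof.
rewrite /normal_prob integral_indicM ge0_integral_even; last 3 first.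
- apply: measurable_funM; first exact: measurable_normal_pdf.
  apply: measurable_indic; rewrite -[X in measurable X]setTI.
  exact: measurable_fun_le.
- by move=> x; rewrite mulr_ge0// normal_pdf_ge0.
- move=> x; rewrite !normal_pdf01E !indicE sqrrN; congr (_ * _ * (nat_of_bool _)%:R).
  by apply/idP/idP; rewrite !inE/= sqrrN.
congr (_ * _)%E; rewrite integral_indicM [RHS]integral_indicM.
apply: eq_integral => x _; congr EFin; rewrite -mulrA; congr (_ * _).
rewrite !indicE -natrM mulnb; congr (nat_of_bool _)%:R.
apply/idP/idP; rewrite !inE/= !in_itv/= !andbT.
  by move=> /andP[/set_mem/= tx /set_mem/=]; rewrite in_itv/= andbT => /sqrt_le->.
move=> tx; have x0 : 0 <= x by rewrite (le_trans _ tx)// sqrtr_ge0.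
apply/andP; split; apply/mem_set => /=; first by rewrite -sqrt_le.
by rewrite in_itv/= x0.
Qed.

Lemma normal_tail_scale a x : 0 < x ->
  (\int[mu]_(y in `[(a * x)%R, +oo[) (phi y)%:E =
   \int[mu]_(v in `[a, +oo[) (phi (v * x) * x)%:E)%E.
Proof.
move=> x0; pose F := fun v : R => v * x.
have dF : F^`()%classic = cst x.
  by apply/funext => z; rewrite /F derive1Mr// derive1_id mul1r.
rewrite (@increasing_ge0_integration_by_substitutiony _ F); first by rewrite dF.
- by move=> v w _ _ vw; rewrite /F ltr_pM2r.
- by rewrite dF => z _; exact: cvg_cst.
- by rewrite dF; exact: is_cvg_cst.
- by rewrite dF; exact: is_cvg_cst.
- split; first by move=> v _; exact: derivableM.
  by apply: cvg_at_right_filter; apply: cvgM => //; exact: cvg_cst.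
- exact: (gt0_cvgMly x0 (@cvg_id _ _)).
- by apply: continuous_subspaceT; apply: continuous_normal_pdf; rewrite oner_neq0.
- by move=> v _; rewrite normal_pdf_ge0.
Qed.

Lemma radial_gaussian_tail c k : 0 <= c -> 0 < k ->
  (\int[mu]_(x in `[c, +oo[) (x * expR (- (x ^+ 2 * k / 2)))%:E =
   (expR (- (c ^+ 2 * k / 2)) / k)%:E)%E.
Proof.
move=> c0 k0; pose F := fun x : R => - (expR (- (x ^+ 2 * k / 2)) / k).
have dG : forall x, is_derive x 1 (fun y : R => - (y ^+ 2 * k / 2)) (- (x * k)).
  by move=> x; apply: is_derive_eq; rewrite /GRing.scale/=; field.
have cG : continuous (fun y : R => - (y ^+ 2 * k / 2)).
  by move=> z; exact/differentiable_continuous/derivable1_diffP.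
have cE : continuous (fun y => expR (- (y ^+ 2 * k / 2))).
  by move=> x; apply: (continuous_comp (cG x)); exact: continuous_expR.
have dE x : is_derive x 1 (fun y => expR (- (y ^+ 2 * k / 2)))
    (expR (- (x ^+ 2 * k / 2)) * - (x * k)).
  exact: (@is_derive1_comp _ expR _ x _ _ (is_derive_expR _) (dG x)).
have dF : forall x, is_derive x 1 F (x * expR (- (x ^+ 2 * k / 2))).
  move=> x; rewrite /F; apply: is_derive_eq; rewrite /GRing.scale/=; field.
  by rewrite gt_eqF.
have cF : continuous F.
  move=> x; exact/differentiable_continuous/derivable1_diffP.
rewrite (@ge0_continuous_FTC2y _ _ F c 0).
- by rewrite sub0e EFinN oppeK.
- by move=> x cx; rewrite mulr_ge0 ?expR_ge0// (le_trans c0).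
- by apply: continuous_subspaceT => x; apply: cvgM; [exact: cvg_id|exact: cE].
- rewrite -oppr0 -(mul0r k^-1); apply: cvgN; apply: cvgM; last exact: cvg_cst.
  apply: (cvg_comp (fun x : R => x ^+ 2 * k / 2) (fun x => expR (- x))).
    apply: gt0_cvgMly => //; apply: gt0_cvgMly => //; exact: cvgr_expr2.
  exact: cvgr_expR.
- by [].
- by apply: cvg_at_right_filter; exact: cF.
- by move=> x _; rewrite derive1E; have [_ ->] := dF x.
Qed.

End normal_integrals.

Section gaussian_radius.
Context {R : realType}.
Implicit Types (a c k s t v x y : R).
Local Notation mu := (@lebesgue_measure R).
Local Notation phi := (@normal_pdf R 0 1).
Local Notation N := (@normal_prob R 0 1).
Local Notation slope_density z := (phi z.1 * phi (z.2 * z.1) * z.1).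

(** In the coordinates x and v = y / x, whose Jacobian is the last factor of
    [slope_density], this is the part of the first quadrant where
    x ^ 2 + y ^ 2 >= s. *)
Let E s := [set z : R * R | [/\ 0 <= z.1, 0 <= z.2 & s <= z.1 ^+ 2 * oneDsqr z.2]].

Let G s (z : R * R) : \bar R := (slope_density z * \1_(E s) z)%:E.

Let mE s : measurable (E s).
Proof.
rewrite (_ : E s = [set z | 0 <= z.1] `&` [set z | 0 <= z.2] `&`
   [set z | s <= z.1 ^+ 2 * oneDsqr z.2]); last first.
  by apply/seteqP; split=> z /=; [move=> []|move=> [[]]].
apply: measurableI; first apply: measurableI.
- rewrite -[X in measurable X]setTI; exact: measurable_fun_le.
- rewrite -[X in measurable X]setTI; exact: measurable_fun_le.
- rewrite -[X in measurable X]setTI; apply: measurable_fun_le => //.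
  apply: measurable_funM; first exact: measurable_funX.
  by rewrite /oneDsqr; apply: measurable_funD => //; exact: measurable_funX.
Qed.

Let mG s : measurable_fun setT (G s).
Proof.
apply/measurable_EFinP; apply: measurable_funM; last exact: measurable_indic.
apply: measurable_funM => //; apply: measurable_funM.
  by apply: measurableT_comp => //; exact: measurable_normal_pdf.
apply: measurableT_comp; first exact: measurable_normal_pdf.
exact: measurable_funM.
Qed.

Let G_ge0 s z : (0 <= G s z)%E.
Proof.
rewrite lee_fin indicE; have [|_] := boolP (z \in E s); last by rewrite mulr0.
by rewrite inE => -[z0 _ _]; rewrite !mulr_ge0// normal_pdf_ge0.
Qed.

Lemma slope_densityE z : slope_density z =
  normal_peak (1 : R) ^+ 2 * (z.1 * expR (- (z.1 ^+ 2 * oneDsqr z.2 / 2))).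
Proof.
rewrite !normal_pdf01E (_ : - (z.1 ^+ 2 * _ / 2) =
  - (z.1 ^+ 2 / 2) + - ((z.2 * z.1) ^+ 2 / 2)) ?expRD; first by ring.
by rewrite /oneDsqr; field.
Qed.

(** Substituting y = v x in the section at x; by parity the half line of
    nonnegative y carries half of the mass. *)
Let integral_G1 s x : 0 < x ->
  (N [set y | (s - x ^+ 2 <= y ^+ 2)%R] * (phi x)%:E =
   2%:E * \int[mu]_v G s (x, v))%E.
Proof.
move=> x0; rewrite normal_prob_sqr_ge -muleA; congr (_ * _)%E.
pose a := Num.sqrt (s - x ^+ 2) / x.
have -> : Num.sqrt (s - x ^+ 2) = a * x by rewrite divfK// gt_eqF.
rewrite normal_tail_scale// muleC.
have mf : measurable_fun setT (fun v : R => phi (v * x) * x).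
  apply: measurable_funM => //; apply: measurableT_comp.
    exact: measurable_normal_pdf.
  exact: measurable_funM.
rewrite -ge0_integralZl//=; last 3 first.
- by apply/measurable_EFinP; apply: measurable_funTS.
- by move=> v _; rewrite lee_fin mulr_ge0 ?normal_pdf_ge0// ltW.
- by rewrite lee_fin normal_pdf_ge0.
under eq_integral do rewrite -EFinM mulrA.
rewrite integral_indicM; apply: eq_integral => v _; congr (_ * _)%:E.
rewrite !indicE; congr (nat_of_bool _)%:R; rewrite mem_setE/= in_itv/= andbT.
have av : (a <= v) = (Num.sqrt (s - x ^+ 2) <= v * x) by rewrite ler_pdivrMr.
rewrite av; apply/idP/idP => [sv|/set_mem/= [_ v0 sv]].
  have vx : 0 <= v * x by rewrite (le_trans _ sv)// sqrtr_ge0.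
  apply/mem_set; split => /=; first exact: ltW.
    by rewrite -(pmulr_lge0 _ x0).
  by move: sv; rewrite sqrt_le// /oneDsqr; lra.
rewrite sqrt_le; first by move: sv; rewrite /oneDsqr/=; lra.
by rewrite mulr_ge0// ltW.
Qed.

(** At a fixed slope v, the integrand is, up to a constant factor, the derivative
    of a Gaussian in x. *)
Let integral_G2 s v : 0 <= s ->
  (\int[mu]_x G s (x, v) =
   (normal_peak (1 : R) ^+ 2 * expR (- (s / 2)) * (oneDsqr v)^-1 *
    \1_(`[0%R, +oo[%classic) v)%:E)%E.
Proof.
move=> s0; have k0 : 0 < oneDsqr v by [].
have [v0|v0] := leP 0 v; last first.
  rewrite indicE memNset ?mulr0; last first.
    by rewrite /= in_itv/= andbT; apply/negP; rewrite -ltNge.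
  rewrite integral0_eq// => x _.
  by rewrite /G indicE memNset ?mulr0// => -[_ /=]; rewrite leNgt v0.
rewrite indicE mem_set ?mulr1; last by rewrite /= in_itv/= v0.
pose c := Num.sqrt (s / oneDsqr v).
have c2 : c ^+ 2 * oneDsqr v = s.
  by rewrite sqr_sqrtr ?divr_ge0 ?(ltW k0)// divfK// gt_eqF.
transitivity (\int[mu]_(x in `[c, +oo[) (slope_density (x, v))%:E)%E.
  rewrite [RHS]integral_indicM; apply: eq_integral => x _; congr (_ * _)%:E.
  rewrite !indicE; congr (nat_of_bool _)%:R; rewrite mem_setE/= in_itv/= andbT.
  apply/idP/idP => [/set_mem[/= x0 _ sx]|cx].
    by rewrite sqrt_le// ler_pdivrMr.
  have x0 : 0 <= x by rewrite (le_trans _ cx)// sqrtr_ge0.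
  by apply/mem_set; split => //=; move: cx; rewrite sqrt_le// ler_pdivrMr.
under eq_integral do rewrite slope_densityE/= EFinM.
rewrite ge0_integralZl//=; last 3 first.
- apply/measurable_EFinP; apply: measurable_funTS.
  apply: measurable_funM => //; apply: measurableT_comp => //.
  by apply: measurableT_comp => //; do !apply: measurable_funM => //;
    exact: measurable_funX.
- move=> x; rewrite /= in_itv/= andbT => cx; rewrite lee_fin mulr_ge0 ?expR_ge0//.
  by rewrite (le_trans _ cx)// sqrtr_ge0.
- by rewrite lee_fin sqr_ge0.
by rewrite radial_gaussian_tail// ?sqrtr_ge0// c2 -EFinM mulrA.
Qed.

(** The square of the radius of a standard Gaussian vector of the plane has an
    exponential law. Instead of polar coordinates, the proof uses the
    coordinates (x, v) with v = y / x, in which the integral splits into an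
    exponential and the integral of 1 / (1 + v ^ 2). *)
Lemma normal_prob2_radius s : 0 <= s ->
  ((N \x N) [set z | (s <= z.1 ^+ 2 + z.2 ^+ 2)%R] = (expR (- (s / 2)))%:E)%E.
Proof.
move=> s0; set A := [set z | _].
have mA : measurable A.
  rewrite -[X in measurable X]setTI; apply: measurable_fun_le => //.
  by apply: measurable_funD; exact: measurable_funX.
pose h x := fine (N (xsection A x)).
have hE x : (h x)%:E = N (xsection A x).
  by rewrite fineK// fin_num_measure//; exact: measurable_xsection.
have xA x : xsection A x = [set y | s - x ^+ 2 <= y ^+ 2].
  by apply/seteqP; split=> y; rewrite /xsection/= inE /A/= => ?; lra.
have mh : measurable_fun setT h.
  by apply: measurableT_comp => //; exact: measurable_fun_xsection.
transitivity (\int[N]_x (h x)%:E)%E.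
  by apply: eq_integral => x _; rewrite hE.
rewrite integral_normal_prob//; last first.
  move=> x; rewrite -2!lee_fin hE measure_ge0/= probability_le1//.
  exact: measurable_xsection.
rewrite ge0_integral_even; last 3 first.
- by apply: measurable_funM => //; exact: measurable_normal_pdf.
- by move=> x; rewrite mulr_ge0 ?normal_pdf_ge0// -lee_fin hE measure_ge0.
- by move=> x; rewrite !normal_pdf01E /h !xA sqrrN.
rewrite -integral_itv_obnd_cbnd; last first.
  apply/measurable_EFinP; apply: measurable_funTS; apply: measurable_funM => //.
  exact: measurable_normal_pdf.
(* one factor 2 comes from the parity in x and the other from the parity in y;
   x = 0 is removed because the slope y / x makes no sense there *)
transitivity (2%:E * \int[mu]_(x in `]0%R, +oo[)
    (2%:E * \int[mu]_v G s (x, v)))%E.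
  congr (_ * _)%E; apply: eq_integral => x; rewrite inE/= in_itv/= andbT => x0.
  by rewrite EFinM hE xA integral_G1.
have mFG : measurable_fun setT (fun x => \int[mu]_v G s (x, v))%E.
  have := @measurable_fun_fubini_tonelli_F _ _ _ _ R mu (G s) (mG s) (G_ge0 s); exact.
rewrite ge0_integralZl//=; last 2 first.
- exact: measurable_funTS.
- by move=> x _; apply: integral_ge0 => v _; exact: G_ge0.
rewrite integral_itv_obnd_cbnd; last exact: measurable_funTS.
rewrite [X in (_ * (_ * X))%E](_ : _ = \int[mu]_x \int[mu]_v G s (x, v))%E; last first.
  rewrite integral_mkcond; apply: eq_integral => x _.
  rewrite patchE mem_setE/= in_itv/= andbT; case: leP => // x0.
  rewrite integral0_eq// => v _.
  by rewrite /G indicE memNset ?mulr0// => -[/=]; rewrite leNgt x0.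
have -> : (\int[mu]_x \int[mu]_v G s (x, v) = \int[mu]_v \int[mu]_x G s (x, v))%E.
  exact: (@fubini_tonelli _ _ _ _ R mu mu (G s) (mG s) (G_ge0 s)).
under eq_integral do rewrite integral_G2//.
rewrite -integral_indicM.
under eq_integral do rewrite EFinM.
rewrite ge0_integralZl//=; last 2 first.
- apply/measurable_EFinP; apply: measurable_funTS.
  by apply: continuous_measurable_fun; exact: continuous_oneDsqrV.
- by rewrite lee_fin mulr_ge0 ?sqr_ge0 ?expR_ge0.
rewrite integral0y_oneDsqr -!EFinM; congr EFin.
transitivity (expR (- (s / 2)) * (normal_peak (1 : R) ^+ 2 * pi *+ 2)).
  by field.
by rewrite normal_peak1_sqr mulr1.
Qed.

End gaussian_radius.

(** * Persistence along an axis *)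

Section joint_law.
Context d (T : measurableType d) (R : realType) (P : probability T R).
Context d1 d2 (T1 : measurableType d1) (T2 : measurableType d2).
Variables (m1 : probability T1 R) (m2 : probability T2 R).
Variables (X : T -> T1) (Y : T -> T2).
Hypotheses (mX : measurable_fun setT X) (mY : measurable_fun setT Y).

Let mXY : measurable_fun setT (fun w => (X w, Y w)).
Proof. exact: measurable_fun_pair. Qed.

(** The measure of C given D, rescaled by q, is a measure on the product that
    has the same values on rectangles as the product measure. Conditioning on
    an event D is what allows a third independent variable to be added. *)
Lemma joint_law_restr (D : set T) (q : R) : measurable D -> 0 <= q ->
  (forall A B, measurable A -> measurable B ->
    P ((X @^-1` A `&` Y @^-1` B) `&` D) = q%:E * (m1 A * m2 B))%E ->
  forall C, measurable C ->
  (P ([set w | C (X w, Y w)] `&` D) = q%:E * (m1 \x m2) C)%E.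
Proof.
move=> mD q0 box C mC.
have mXYC : measurable [set w | C (X w, Y w)].
  by rewrite -[X in measurable X]setTI; exact: mXY.
(* the rescaling by 1 / q needs q != 0; otherwise D is negligible *)
have [q_eq0|q_neq0] := eqVneq q 0.
  have PD : P D = 0%E.
    have := box setT setT measurableT measurableT.
    by rewrite !preimage_setT !setTI q_eq0 mul0e.
  rewrite q_eq0 mul0e; apply/eqP; rewrite eq_le measure_ge0 andbT -PD.
  by rewrite le_measure ?inE//; exact: measurableI.
have qV0 : 0 <= q^-1 by rewrite invr_ge0.
pose m' : {measure set (T1 * T2) -> \bar R} :=
  mscale (NngNum qV0) (pushforward (mrestr P mD) (fun w => (X w, Y w))).
rewrite (@product_measure_unique _ _ _ _ R m1 m2 (m' mXY))//.
  by rewrite /m'/= /mscale/= /pushforward/mrestr/= muleA -EFinM mulfV// mul1e.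
move=> A B mA mB; rewrite /m'/= /mscale/= /pushforward/mrestr/=.
rewrite [X in P X](_ : _ = (X @^-1` A `&` Y @^-1` B) `&` D)//.
by rewrite box// muleA -EFinM mulVf// mul1e.
Qed.

Lemma joint_law : (forall A B, measurable A -> measurable B ->
    P (X @^-1` A `&` Y @^-1` B) = m1 A * m2 B)%E ->
  forall C, measurable C -> (P [set w | C (X w, Y w)] = (m1 \x m2) C)%E.
Proof.
move=> box C mC; rewrite -[RHS]mul1e -(@joint_law_restr setT)// ?setIT//.
by move=> A B mA mB; rewrite setIT mul1e box.
Qed.

End joint_law.

Section cone.
Context {R : realType}.
Local Notation N := (@normal_prob R 0 1).

(** The product of exp (- x ^ 2 / 2) by the normal density is a constant
    multiple of exp (- x ^ 2), whose integral is sqrt pi. *)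
Lemma integral_expR_normal :
  (\int[N]_x (expR (- (x ^+ 2 / 2)))%:E = (Num.sqrt 2 / 2)%:E)%E.
Proof.
have pi0 := @pi_gt0 R.
rewrite integral_normal_prob; last 2 first.
- apply: measurableT_comp => //; apply: measurableT_comp => //.
  by apply: measurable_funM => //; exact: measurable_funX.
- by move=> x; rewrite expR_ge0/= -expR0 ler_expR lerNl oppr0 divr_ge0 ?sqr_ge0.
have expE (x : R) : expR (- (x ^+ 2 / 2)) * normal_pdf 0 1 x =
    normal_peak 1 * gauss_fun x.
  by rewrite normal_pdf01E mulrCA -expRD; congr (_ * expR _); field.
under eq_integral do rewrite expE EFinM.
rewrite ge0_integralZl//=; last 3 first.
- by apply/measurable_EFinP; exact: measurable_gauss_fun.
- by move=> x _; rewrite lee_fin gauss_fun_ge0.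
- by rewrite lee_fin normal_peak_ge0.
rewrite integralT_gauss -EFinM; congr EFin.
rewrite /normal_peak expr1n mul1r -mulr_natr sqrtrM ?(ltW pi0)//.
have s2 : Num.sqrt 2 != 0 :> R by rewrite gt_eqF// sqrtr_gt0.
have sp : Num.sqrt pi != 0 :> R by rewrite gt_eqF// sqrtr_gt0.
rewrite invfM mulrAC mulVf// mul1r.
have s22 : Num.sqrt 2 ^+ 2 = 2 :> R by rewrite sqr_sqrtr.
by rewrite -[X in _ = _ / X]s22 expr2 invfM mulrA mulfV// mul1r.
Qed.

Lemma normal_prob3_outside_cone : ((N \x (N \x N)) [set z | (z.1 ^+ 2 <=
  z.2.1 ^+ 2 + z.2.2 ^+ 2)%R] = (Num.sqrt 2 / 2)%:E)%E.
Proof.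
rewrite -integral_expR_normal; apply: eq_integral => x _.
have xs : xsection [set z : R * (R * R) | z.1 ^+ 2 <= z.2.1 ^+ 2 + z.2.2 ^+ 2] x
    = [set z : R * R | x ^+ 2 <= z.1 ^+ 2 + z.2 ^+ 2].
  by apply/seteqP; split=> z; rewrite /xsection/= inE.
by rewrite /comp xs normal_prob2_radius// sqr_ge0.
Qed.

End cone.

Section persistence_along_axis.
Context d (T : measurableType d) (R : realType) (P : probability T R).
Context (b1 b2 c1 c2 : {RV P >-> R}).
Hypothesis iid : iid_standard_normal [tuple b1; b2; c1; c2].

Let mcone : measurable [set z : R * (R * R) | z.1 ^+ 2 <= z.2.1 ^+ 2 + z.2.2 ^+ 2].
Proof.
rewrite -[X in measurable X]setTI; apply: measurable_fun_le => //.
  exact: measurable_funX.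
apply: measurable_funD; apply: measurable_funX.
- by apply: measurableT_comp => //; exact: measurable_snd.
- by apply: measurableT_comp => //; exact: measurable_snd.
Qed.

(** The vector (b2, (b1, c1)) has the product law: the pair (b1, c1) is treated
    first, on the event that b2 belongs to a given set. *)
Lemma prob_outside_cone : (P [set w | (b2 w ^+ 2 <= b1 w ^+ 2 + c1 w ^+ 2)%R] =
  (Num.sqrt 2 / 2)%:E)%E.
Proof.
rewrite -normal_prob3_outside_cone.
have mbc : measurable_fun setT (fun w => (b1 w, c1 w)).
  exact: measurable_fun_pair.
pose N : probability _ R := @normal_prob R 0 1.
apply: (@joint_law _ _ _ P _ _ _ _ N (N \x N)%E b2 (fun w => (b1 w, c1 w))
  (measurable_funPT b2) mbc _ _ mcone) => //.
move=> A C mA mC; have mAb2 : measurable (b2 @^-1` A).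
  by rewrite -[X in measurable X]setTI; exact: (measurable_funP b2).
rewrite setIC -[X in P (X `&` _)]/[set w | C (b1 w, c1 w)].
rewrite -[in RHS](@fineK _ (N A)) ?fin_num_measure//.
apply: (joint_law_restr (m1 := N) (m2 := N) (measurable_funPT b1)
  (measurable_funPT c1) mAb2 _ _ mC).
  by rewrite fine_ge0.
move=> B1 B2 mB1 mB2; rewrite fineK ?fin_num_measure//.
have := iid_box iid mB1 mA mB2 measurableT.
rewrite probability_setT mule1 => box.
rewrite muleC -box; congr (P _); apply/seteqP.
by split=> w /=; [move=> [[]]|move=> []].
Qed.

(** The field is b1 cos t + c1 sin t + b2, and the first two terms sweep exactly
    the segment [- r, r], where r = sqrt (b1 ^ 2 + c1 ^ 2). *)
Lemma persistence_axis L : 2 * pi <= L ->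
  persistence_probability P (cilleruelo_field b1 b2 c1 c2) 0 L =
  (1 - Num.sqrt 2 / 2)%:E.
Proof.
move=> L2pi; have mC : measurable [set w | b2 w ^+ 2 <= b1 w ^+ 2 + c1 w ^+ 2].
  rewrite -[X in measurable X]setTI; apply: measurable_fun_le => //.
    exact: measurable_funX.
  by apply: measurable_funD; exact: measurable_funX.
rewrite persistenceE EFinB -prob_outside_cone -probability_setC//; congr (P _).
have waveE w t : wave (b1 w) (c1 w) (b2 w) (c2 w) (cos 0) (sin 0) t =
    wave (b1 w) (c1 w) (b2 w) 0 1 0 t.
  by rewrite /wave cos0 sin0 !mulr0 sin0 !mulr0.
apply/seteqP; split=> w /=.
  move=> noz r21; have [||t tL t0] := @wave_has_zero _ (b1 w) (c1 w) (b2 w) 0 1 0 L ltr01.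
  - by rewrite mulr1.
  - by rewrite expr0n addr0.
  by have /eqP := noz t tL; apply; rewrite waveE.
move=> /negP; rewrite -ltNge => r12 t tL; rewrite waveE; apply/eqP.
rewrite /wave mulr1 mulr0 cos0 sin0 mulr1 mulr0 addr0 => zero.
have := cos2Dsin2 t; have := sqr_ge0 (b1 w * sin t - c1 w * cos t).
have : b2 w ^+ 2 = (b1 w * cos t + c1 w * sin t) ^+ 2.
  by rewrite (_ : b2 w = - (b1 w * cos t + c1 w * sin t)) ?sqrrN//; lra.
nra.
Qed.

End persistence_along_axis.

(** * The bounds on the persistence probability *)

Section constants.
Context {R : realType}.
Implicit Types (u x eps L : R).

Lemma sin_le_id x : 0 <= x -> sin x <= x.
Proof.
move=> x0; have [|c] := @MVT_segment R sin cos 0 x x0 (fun y _ => is_derive_sin y).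
  by apply: continuous_subspaceT; exact: continuous_sin.
by rewrite sin0 !subr0 => _ ->; rewrite ler_piMl// cos_le1.
Qed.

(** The probability of the box of [slow_box_no_zero]. Truncating eps at 1 keeps
    sin eps positive, and weakens the condition on the length. *)
Definition slow_const eps : R :=
  let k := 7 / sin (Num.min eps 1) in
  normal_segment (-1) 1 * normal_segment (-1) 1 * normal_segment 3 4 *
  normal_segment k (k + 1).

(** The probability of the box of [quarter_turn_box_zero]. *)
Definition quarter_turn_const eps : R :=
  let k := 3 / sin (Num.min eps 1) in
  normal_segment (-1) 1 * normal_segment (-1) 1 * normal_segment k (k + 1) *
  normal_segment (-1) 1.

(** The box of [short_box_zero] has probability at least [short_const] * x ^ 2:
    the segment [0, sin x] has length at least x cos 1. *)
Definition short_const : R :=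
  (normal_pdf 0 1 1 * cos 1) ^+ 2 * normal_segment (-4) (-3) *
  normal_segment (-1) 0.

Lemma slow_const_gt0 eps : 0 < slow_const eps.
Proof. by rewrite /slow_const !mulr_gt0// normal_segment_gt0//; lra. Qed.

Lemma quarter_turn_const_gt0 eps : 0 < quarter_turn_const eps.
Proof. by rewrite /quarter_turn_const !mulr_gt0// normal_segment_gt0//; lra. Qed.

Lemma quarter_turn_const_le1 eps : quarter_turn_const eps <= 1.
Proof.
by rewrite /quarter_turn_const; do !rewrite mulr_ile1 ?mulr_ge0
  ?normal_segment_ge0 ?normal_segment_le1//.
Qed.

Lemma short_const_gt0 : 0 < short_const.
Proof.
by rewrite /short_const !mulr_gt0 ?exprn_gt0 ?normal_segment_gt0 ?mulr_gt0
  ?normal_pdf_gt0 ?cos1_gt0//; lra.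
Qed.

End constants.

Section persistence.
Context d (T : measurableType d) (R : realType) (P : probability T R).
Context (b1 b2 c1 c2 : {RV P >-> R}).
Hypothesis iid : iid_standard_normal [tuple b1; b2; c1; c2].
Local Notation p := (persistence_probability P (cilleruelo_field b1 b2 c1 c2)).
Implicit Types (u eps L : R).

Lemma persistence_ge_slow eps u L : 0 < eps -> 0 <= u <= pi / 4 -> 0 < L ->
  L * sin u < pi - eps -> ((slow_const eps)%:E <= p u L)%E.
Proof.
move=> e0 u04 L0 Lu; set e := Num.min eps 1.
have e01 : 0 < e <= 1 by rewrite lt_min e0 ltr01 ge_min lexx orbT.
have ee : e <= eps by rewrite ge_min lexx.
apply: (persistence_ge_box iid L0) => w [b1w c1w b2w c2w] t tL.
apply: (slow_box_no_zero e01 u04 _ b1w c1w b2w _ tL); first by lra.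
by move: c2w; rewrite in_itv/= => /andP[].
Qed.

Lemma persistence_le_quarter_turn eps u L : 0 < eps -> 0 <= u <= pi / 4 ->
  0 < L -> pi / 2 + eps < L * sin u ->
  (p u L <= (1 - quarter_turn_const eps)%:E)%E.
Proof.
move=> e0 u04 L0 Lu; set e := Num.min eps 1.
have e01 : 0 < e <= 1 by rewrite lt_min e0 ltr01 ge_min lexx orbT.
have ee : e <= eps by rewrite ge_min lexx.
apply: (persistence_le_box iid L0) => w [b1w c1w b2w c2w].
apply: (quarter_turn_box_zero e01 u04 _ b1w c1w _ c2w); first by lra.
by move: b2w; rewrite in_itv/= => /andP[].
Qed.

Lemma persistence_eq0 u L : 0 < u <= pi / 4 -> 0 < L -> 2 * pi <= L * sin u ->
  p u L = 0%E.
Proof.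
move=> /andP[u0 u4] L0 Lu.
have /sin_le_cos/andP[_ sc] : 0 <= u <= pi / 4 by rewrite ltW.
have pi0 := @pi_gt0 R.
have su : 0 < sin u by rewrite sin_gt0_pi// u0/=; lra.
rewrite persistenceE [X in P X](_ : _ = set0) ?measure0// -subset0 => w /= noz.
have [t /noz/eqP] := wave_has_zero_slow (b1 w) (c1 w) (b2 w) (c2 w) su sc Lu.
by [].
Qed.

Lemma persistence_le_short x u L : 0 <= x <= 2^-1 -> 0 <= u <= pi / 4 ->
  x <= L * sin u -> 0 < L -> (p u L <= (1 - short_const * x ^+ 2)%:E)%E.
Proof.
move=> x01 u04 xL L0.
have := persistence_le_box iid L0 (fun w E =>
  let: And4 b1w c1w b2w c2w := E in short_box_zero x01 u04 xL L0 b1w c1w b2w c2w).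
move/le_trans; apply; rewrite lee_fin lerD2l lerN2.
have sx := sin_ge_linear x01; have /andP[x0 x1] := x01.
have cos1 := @cos1_gt0 R; have phi1 := @normal_pdf_gt0 R 1.
have sx0 : 0 <= sin x by rewrite (le_trans _ sx)// mulr_ge0// ltW.
have short : normal_pdf 0 1 1 * cos 1 * x <= normal_segment 0 (sin x).
  apply: le_trans (normal_segment_ge sx0 (M := 1) _ _).
  - by rewrite subr0 -mulrA [leRHS]mulrC ler_pM2l.
  - by rewrite normr0.
  - by rewrite ger0_norm// sin_le1.
have short2 : (normal_pdf 0 1 1 * cos 1 * x) ^+ 2 <= normal_segment 0 (sin x) ^+ 2.
  by rewrite ler_sqr ?nnegrE ?normal_segment_ge0 ?mulr_ge0 ?(ltW phi1) ?(ltW cos1).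
have n1 := @normal_segment_ge0 R (-4) (-3); have n2 := @normal_segment_ge0 R (-1) 0.
rewrite /short_const.
rewrite (_ : _ * x ^+ 2 = (normal_pdf 0 1 1 * cos 1 * x) ^+ 2 *
  (normal_segment (-4) (-3) * normal_segment (-1) 0)); last by ring.
rewrite [leRHS](_ : _ = normal_segment 0 (sin x) ^+ 2 *
  (normal_segment (-4) (-3) * normal_segment (-1) 0)); last by ring.
by rewrite ler_wpM2r// mulr_ge0.
Qed.

Lemma persistence_le_gaussian u L : 0 < u < pi / 4 -> 0 < L ->
  (p u L <= (expR (- (short_const / 16 ^+ 2 * L ^+ 2 * sin u ^+ 2)))%:E)%E.
Proof.
move=> /andP[u0 u4] L0; have pi0 := @pi_gt0 R; have pi2 := @pihalf_lt2 R.
have u04 : 0 <= u <= pi / 4 by rewrite !ltW.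
have [Lu|Lu] := leP (2 * pi) (L * sin u).
  by rewrite persistence_eq0 ?lee_fin ?expR_ge0 ?u0 ?(ltW u4).
have su : 0 < sin u by rewrite sin_gt0_pi// u0/=; lra.
have Lu0 : 0 < L * sin u by rewrite mulr_gt0.
(* since L sin u < 2 pi < 8, the factor 1 / 16 brings x below 1 / 2 *)
pose x := L * sin u / 16.
have x01 : 0 <= x <= 2^-1 by rewrite /x; lra.
apply: (le_trans (persistence_le_short x01 u04 _ L0)); first by rewrite /x; lra.
rewrite lee_fin; apply: le_trans (expR_ge1Dx _).
by rewrite lerD2l lerN2 /x; lra.
Qed.

End persistence.

Theorem proposition1p7 (R : realType) :
  exists (C0 : R -> R) (C2 C3 C4 : R) (C5 C6 : R -> R),
    [/\ forall C1 : R, 0 < C1 -> C1 < pi / 2 -> 0 < C0 C1,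
        [/\ 0 < C2, 0 < C3 & 0 < C4],
        forall eps : R, 0 < eps -> 0 < C5 eps &
        forall eps : R, 0 < eps -> 0 < C6 eps /\ C6 eps < 1] /\
    forall (d : measure_display) (T : measurableType d) (P : probability T R)
      (b1 b2 c1 c2 : {RV P >-> R}),
      iid_standard_normal [tuple b1; b2; c1; c2] ->
      let F := cilleruelo_field b1 b2 c1 c2 in
      let p := persistence_probability P F in
      (* (i) *)
      (forall L : R, 2 * pi <= L -> p 0 L = (1 - Num.sqrt 2 / 2)%:E) /\
      (* (ii) *)
      (forall C1 : R, 0 < C1 -> C1 < pi / 2 ->
        \forall s \near C1^'-, forall u L : R,
          0 <= u <= pi / 4 -> 0 < L -> L * u = s ->
          ((C0 C1)%:E <= p u L)%E) /\
      (* (iii) *)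
      (\forall s \near (pi / 2 : R)^'-, forall u L : R,
        0 <= u <= pi / 4 -> 0 < L -> L * u = s ->
        ((C2 * expR (- (C3 / (L * u - pi / 2) ^+ 2)))%:E <= p u L)%E) /\
      (* (iv) *)
      (forall u : R, 0 < u < pi / 4 -> forall L : R, 0 < L ->
        (p u L <= (expR (- (C4 * L ^+ 2 * sin u ^+ 2)))%:E)%E) /\
      (* (v) *)
      (forall eps u L : R, 0 < eps -> 0 <= u <= pi / 4 -> 0 < L ->
        L * sin u < pi - eps -> ((C5 eps)%:E <= p u L)%E) /\
      (* (vi) *)
      (forall eps u L : R, 0 < eps -> 0 <= u <= pi / 4 -> 0 < L ->
        pi / 2 + eps < L * sin u -> (p u L <= (C6 eps)%:E)%E) /\
      (* (vii) *)
      (forall u L : R, 0 < u <= pi / 4 -> 0 < L ->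
        2 * pi <= L * sin u -> p u L = 0%E).
Proof.
(* halving the probability of the box keeps the last constant positive *)
exists (fun=> slow_const 1), (slow_const 1), 1, (short_const / 16 ^+ 2), slow_const,
  (fun eps => 1 - quarter_turn_const eps / 2).
have slow0 := @slow_const_gt0 R; have short0 := @short_const_gt0 R.
split.
  split=> [C1 _ _||eps _|eps _]; [exact: slow0| |exact: slow0|].
    split; [exact: slow0|exact: ltr01|apply: divr_gt0; first exact: short0].
    exact: (exprn_gt0 2 (ltr0Sn R 15)).
  have := quarter_turn_const_gt0 eps; have := quarter_turn_const_le1 eps.
  by split; lra.
move=> d T P b1 b2 c1 c2 iid F p.
(* the two regimes where L u is below pi / 2 share this bound: there
   L sin u <= L u < pi / 2 <= pi - 1 *)
have lower u L : 0 <= u <= pi / 4 -> 0 < L -> L * u < pi / 2 ->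
    ((slow_const 1)%:E <= p u L)%E.
  move=> u04 L0 Lu; apply: persistence_ge_slow => //.
  have /sin_le_id su : 0 <= u by have /andP[] := u04.
  have : L * sin u <= L * u by rewrite ler_pM2l.
  by have := @pi_ge2 R; lra.
split; first exact: persistence_axis.
split.
  move=> C1 C10 C1pi; near=> s => u L u04 L0 Ls; apply: lower => //.
  by rewrite Ls (lt_trans _ C1pi).
split.
  near=> s => u L u04 L0 Ls; apply: le_trans (lower u L u04 L0 _).
    rewrite lee_fin ler_piMr ?(ltW (slow0 _))// -expR0 ler_expR oppr_le0.
    by rewrite divr_ge0 ?sqr_ge0.
  by rewrite Ls.
split; first by move=> u u04 L; exact: persistence_le_gaussian.
split; first exact: persistence_ge_slow.
split; last exact: persistence_eq0.
move=> eps u L e0 u04 L0 Lu.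
apply: (le_trans (persistence_le_quarter_turn iid e0 u04 L0 Lu)).
by rewrite lee_fin; have := quarter_turn_const_gt0 eps; lra.
Unshelve. all: by end_near.
Qed.
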